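(* For any integer $d\ge 2$, both the graph $\Lambda(d)$ and the subgraph induced in $\Lambda(d)$ by the simplices (polytopes with $d+1$ vertices) and the polytopes with $d+2$ vertices are connected.
   Context: A lattice polytope is a polytope whose vertices all belong to $\mathbb{Z}^d$. Let $P\subset\mathbb{R}^d$ be a $d$-dimensional polytope with vertex set $\mathcal{V}$. A point $x\in\mathbb{R}^d\setminus P$ can be inserted in $P$ if the vertex set of the convex hull of $P\cup\{x\}$ is exactly $\mathcal{V}\cup\{x\}$; the insertion move then replaces $P$ by this convex hull. A vertex $v\in\mathcal{V}$ can be deleted from $P$ if the convex hull of $\mathcal{V}\setminus\{v\}$ is still $d$-dimensional; the deletion move then replaces $P$ by this convex hull. $\Lambda(d)$ is the undirected graph whose vertices are all $d$-dimensional lattice polytopes contained in $\mathbb{R}^d$ and whose edges connect two such polytopes when one is obtained from the other by a single insertion move (equivalently, the other by a single deletion move). *)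

(* Defs.v *)
From HB Require Import structures.
From mathcomp Require Import all_boot all_order all_algebra.
From mathcomp Require Import boolp classical_sets functions cardinality reals.
From mathcomp Require Import convex.
From Stdlib Require Import Relation_Operators.

Set Implicit Arguments.
Unset Strict Implicit.
Unset Printing Implicit Defensive.
Import Order.TTheory GRing.Theory Num.Theory.

Local Open Scope classical_set_scope.
Local Open Scope ring_scope.

(** Graphs with a possibly infinite set of vertices. *)

Record graph (T : Type) := Graph {
  gvertex : set T;
  gedge : T -> T -> Prop }.

Definition induced_subgraph (T : Type) (G : graph T) (S : set T) : graph T :=
  {| gvertex := gvertex G `&` S;
     gedge := fun x y => [/\ gedge G x y, S x & S y] |}.

(* Walks must stay inside [gvertex G]. The empty graph is not connected. *)
Definition graph_connected (T : Type) (G : graph T) : Prop :=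
  gvertex G !=set0 /\
  forall x y, gvertex G x -> gvertex G y ->
    clos_refl_trans T
      (fun a b => [/\ gvertex G a, gvertex G b & gedge G a b]) x y.

Section Polytopes.
Context (R : realType) (d : nat).
Local Notation E := 'rV[R]_d.
Implicit Types (A P Q S : set E) (v x y : E).

Definition convex_hull A : set E := smallest (@convex_set R E) A.

Definition affine_set A : Prop :=
  forall x y (t : R), A x -> A y -> A (t *: x + (1 - t) *: y).

Definition affine_hull A : set E := smallest affine_set A.

(* The affine hull of A is the translate by p of a k-dimensional linear
   subspace. No k satisfies this when A is empty. *)
Definition has_dim A (k : nat) : Prop :=
  exists (p : E) (U : {vspace E}),
    affine_hull A = [set x | x - p \in U] /\ \dim U = k.

Definition polytope P : Prop :=
  exists2 S, finite_set S & P = convex_hull S.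

(* Vertices are the extreme points. *)
Definition vertices P : set E :=
  [set v | P v /\
    forall x y (t : R), P x -> P y -> 0 < t < 1 ->
      v = t *: x + (1 - t) *: y -> x = v /\ y = v].

Definition lattice_point v : Prop := forall i, v 0 i \is a Num.int.

Definition lattice_polytope P : Prop :=
  polytope P /\ forall v, vertices P v -> lattice_point v.

Definition can_insert P x : Prop :=
  ~ P x /\ vertices (convex_hull (P `|` [set x])) = vertices P `|` [set x].

Definition insertion_move P Q : Prop :=
  exists2 x, can_insert P x & Q = convex_hull (P `|` [set x]).

Definition Lambda_vertices : set (set E) :=
  [set P | lattice_polytope P /\ has_dim P d].

Definition Lambda : graph (set E) :=
  {| gvertex := Lambda_vertices;
     gedge := fun P Q => [/\ Lambda_vertices P, Lambda_vertices Q
                           & insertion_move P Q \/ insertion_move Q P] |}.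

Definition has_n_vertices (n : nat) : set (set E) :=
  [set P | (vertices P #= `I_n)%card].

End Polytopes.

Arguments Lambda R d : clear implicits.
Arguments has_n_vertices R d n : clear implicits.

(* Main.v *)
Require Import Defs.
From mathcomp Require Import all_boot all_order all_algebra perm.
From mathcomp Require Import boolp classical_sets functions cardinality reals.
From mathcomp Require Import finmap interval_inference convex ring.
From Stdlib Require Import Relation_Operators.

Set Implicit Arguments.
Unset Strict Implicit.
Unset Printing Implicit Defensive.
Import Order.TTheory GRing.Theory Num.Theory.

Local Open Scope classical_set_scope.
Local Open Scope ring_scope.

(** The theorem reduces to exchanging one vertex of a lattice simplex.

    A polytope is the hull of its finite set of vertices, and a set is the
    vertex set of its hull exactly when it is convexly independent. If a
    full-dimensional polytope is not a simplex, its vertices contain an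
    affine basis and at least one vertex outside that basis; this vertex can
    be deleted and the dimension is kept. Repeating this leads from any
    polytope to a simplex ([walk_to_simplex]), and from a polytope with
    [d + 2] vertices in one move. It remains to join any two lattice simplices
    through polytopes with at most [d + 2] vertices.

    Let [x] have barycentric coordinates [b i] with respect to a simplex [v].
    Up to scaling, the only affine dependence between the vertices and [x] is
    [x = \sum_i b i *: v i]. If at least two of the [b i] are positive and one
    is negative, both sides of this Radon dependence have at least two points,
    so that the [d + 2] points are in convex position
    ([circuit_convexly_independent]). Inserting [x] and then deleting a vertex
    [v k] with [b k != 0] replaces [v k] by [x] ([circuit_walk]).

    This suffices to replace [v k] by an arbitrary lattice point [x] off the
    hyperplane of the opposite facet ([facet_walk]). When [x] and [v k] lie on
    the same side of that hyperplane, both can be replaced by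
    [c = v k + N *: (v i - v j)], where [v i] and [v j] are two vertices of the
    facet, which exist because [d >= 2].
    Relative to either simplex the coordinates of [c] at [k] and at [i] are
    positive and its coordinate at [j] is negative, once [N] is large. When
    [x] and [v k] lie on opposite sides, [v k] is first replaced by
    [v i + v j - v k], whose coordinates are [1], [1], [-1].

    Finally the Steinitz exchange of affine bases changes any simplex into
    any other one vertex at a time ([simplex_walk]). *)

(** * Finite cardinals *)

Lemma card_setU1 (T : Type) (A : set T) (x : T) n :
  ~ A x -> (A #= `I_n)%card -> (A `|` [set x] #= `I_n.+1)%card.
Proof.
move=> Ax An; apply/eq_cardSP; exists x; first by right.
suff -> : (A `|` [set x]) `\ x = A by [].
apply/seteqP; split=> [y [[//|->] xx]|y Ay]; first by case: xx.
by split; [left|move=> /= yx; apply: Ax; rewrite -yx].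
Qed.

Lemma card_setD1 (T : choiceType) (A : set T) (x : T) n :
  A x -> (A #= `I_n.+1)%card -> (A `\ x #= `I_n)%card.
Proof.
move=> Ax An; have fA : finite_set A by apply/finite_setP; exists n.+1.
rewrite -(fset_setK (finite_setD [set x] fA)); apply/card_eq_fsetP.
have := card_fset_set An; rewrite (cardfsD1 x) fset_setD1//.
by rewrite in_fset_set// mem_set// add1n => -[].
Qed.

(** * Convex hulls and their vertices *)

Section Hull.
Context {R : realType} {d : nat}.
Local Notation E := 'rV[R]_d.
Implicit Types (A B C P Q : set E) (v x y : E).

(** This form, with a scalar in the open interval, is the one that the
    definition of an extreme point uses. *)
Lemma convex_setE A :
  @convex_set R E A <->
  forall x y (t : R), A x -> A y -> 0 < t < 1 -> A (t *: x + (1 - t) *: y).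
Proof.
split=> [cA x y t Ax Ay /andP[t0 t1]|cA].
  by apply/set_mem/(cA x y (Itv01 (ltW t0) (ltW t1))); apply/mem_set.
apply/convex_setW => x y /set_mem Ax /set_mem Ay k k0 k1.
by apply/mem_set; apply: cA; rewrite ?k0 ?k1.
Qed.

Lemma convex_convex_hull A : convex_set (convex_hull A).
Proof.
move=> x y t /set_mem xA /set_mem yA; apply/mem_set => C [cC AC].
by apply/set_mem/cC; apply/mem_set; [apply: xA|apply: yA].
Qed.

Lemma sub_convex_hull A : A `<=` convex_hull A.
Proof. exact: sub_gen_smallest. Qed.

Lemma convex_hull_min A C : convex_set C -> A `<=` C -> convex_hull A `<=` C.
Proof. exact: smallest_sub. Qed.

Lemma convex_hull_mono A B : A `<=` B -> convex_hull A `<=` convex_hull B.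
Proof.
move=> AB; apply: convex_hull_min (@convex_convex_hull B) _.
by move=> x /AB/sub_convex_hull.
Qed.

Lemma convex_hullU A B :
  convex_hull (convex_hull A `|` B) = convex_hull (A `|` B).
Proof.
apply/seteqP; split.
  apply: convex_hull_min (@convex_convex_hull _) _ => x [|Bx].
    by apply: convex_hull_mono => y; left.
  by apply: sub_convex_hull; right.
apply: convex_hull_mono => x [Ax|]; last by right.
by left; apply: sub_convex_hull.
Qed.

Definition convexly_independent A := forall a, A a -> ~ convex_hull (A `\ a) a.

Lemma convexly_independentS A B :
  A `<=` B -> convexly_independent B -> convexly_independent A.
Proof.
move=> AB iB a Aa hAa; apply: (iB a (AB _ Aa)); move: hAa.
by apply: convex_hull_mono => x [/AB].
Qed.

(** A convex set that contains the generators of a hull but misses a point of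
    the hull contradicts minimality; extremality of [v] supplies such a set. *)
Lemma convex_setD1_vertex P v :
  convex_set P -> vertices P v -> @convex_set R E (P `\ v).
Proof.
move=> /convex_setE cP [Pv ext]; apply/convex_setE.
move=> x y t [Px xv] [Py yv] t01; split; first exact: cP.
by move=> /= e; have [] := ext x y t Px Py t01 (esym e).
Qed.

(** This is the open cone with apex [v] over [Q]; it misses the apex when
    [v] is not in [Q]. *)
Lemma open_ray_cone_convex Q v :
  @convex_set R E Q ->
  @convex_set R E [set x | exists2 s : R, 0 < s & Q (v + s *: (x - v))].
Proof.
move=> /convex_setE cQ; apply/convex_setE => x y t.
move=> [s s0 Qx] [r r0 Qy] /andP[t0 t1].
have D0 : 0 < t * r + (1 - t) * s by rewrite addr_gt0 ?mulr_gt0 ?subr_gt0.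
(* The reciprocal of the new dilation factor is the mean of the reciprocals
   of [s] and [r] with weights [t] and [1 - t]. *)
exists (s * r / (t * r + (1 - t) * s)); first by rewrite divr_gt0 ?mulr_gt0.
set u := (X in Q X).
suff -> : u = t * r / (t * r + (1 - t) * s) *: (v + s *: (x - v)) +
    (1 - t * r / (t * r + (1 - t) * s)) *: (v + r *: (y - v)).
  apply: cQ => //; rewrite divr_gt0 ?mulr_gt0//= ltr_pdivrMr// mul1r ltrDl.
  by rewrite mulr_gt0 ?subr_gt0.
apply/rowP => i; rewrite !mxE; field; exact: lt0r_neq0.
Qed.

(** A vertex of the hull lies in [A], and not in the hull of the rest of [A],
    because removing it leaves a convex set. Conversely, if [a] is not in the
    hull of the other points, the open cone with apex [a] over that hull is
    convex, misses [a], and together with [a] contains the whole hull; so [a]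
    is in no open segment of the hull. *)
Lemma vertices_convex_hull A :
  vertices (convex_hull A) = [set a | A a /\ ~ convex_hull (A `\ a) a].
Proof.
apply/seteqP; split=> [v vP|v [Av nv]].
  have cD := convex_setD1_vertex (@convex_convex_hull A) vP.
  split.
    apply: contrapT => nAv.
    have /(_ v) : convex_hull A `<=` convex_hull A `\ v.
      apply: convex_hull_min cD _ => a Aa; split; first exact: sub_convex_hull.
      by move=> /= av; apply: nAv; rewrite -av.
    by case: vP => hv _ /(_ hv)[_]; apply.
  move=> vD; have /(_ v vD) : convex_hull (A `\ v) `<=` convex_hull A `\ v.
    apply: convex_hull_min cD _ => a [Aa av]; split=> //.
    exact: sub_convex_hull.
  by case=> _; apply.
set Q := convex_hull (A `\ v) in nv.
pose K : set E := [set x | exists2 s : R, 0 < s & Q (v + s *: (x - v))].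
have /convex_setE cK : @convex_set R E K.
  exact/open_ray_cone_convex/convex_convex_hull.
have nKv : ~ K v by case=> s _; rewrite subrr scaler0 addr0.
have Kv x t : K x -> 0 < t -> K (t *: x + (1 - t) *: v).
  move=> [s s0 Qx] t0; exists (s / t); first exact: divr_gt0.
  set u := (X in Q X); suff -> : u = v + s *: (x - v) by [].
  by apply/rowP => i; rewrite !mxE; field; rewrite gt_eqF.
have sK : convex_hull A `<=` K `|` [set v].
  apply: convex_hull_min.
    apply/convex_setE => x y t [Kx|->] [Ky|->] /[dup] t01 /andP[t0 t1].
    - by left; apply: cK.
    - by left; apply: Kv.
    - left; rewrite addrC -{2}(subKr 1 t); apply: Kv => //.
      by rewrite subr_gt0.
    - by right; rewrite /= -scalerDl subrKC scale1r.
  move=> a Aa; have [->|av] := eqVneq a v; first by right.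
  left; exists 1 => //; rewrite scale1r subrKC; apply: sub_convex_hull.
  by split=> //; apply/eqP.
split; first exact: sub_convex_hull.
move=> x y t /sK[Kx|->] /sK[Ky|->] /[dup] t01 /andP[t0 t1] // e.
- by case: nKv; rewrite e; apply: cK.
- by case: nKv; rewrite {1}e; apply: Kv.
- case: nKv; rewrite {1}e addrC -{2}(subKr 1 t); apply: Kv => //.
  by rewrite subr_gt0.
Qed.

Lemma vertices_convexly_independent A :
  convexly_independent A -> vertices (convex_hull A) = A.
Proof.
move=> iA; rewrite vertices_convex_hull; apply/seteqP; split=> a; first by case.
by move=> Aa; split=> //; apply: iA.
Qed.

(** Points lying in the hull of the other points are discarded one by one. *)
Lemma finite_hull_basis A : finite_set A ->
  exists B,
    [/\ B `<=` A, convexly_independent B & convex_hull B = convex_hull A].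
Proof.
move=> /finite_setP[n]; elim: n A => [|n IH] A An.
  exists A; split=> // a Aa; move: An; rewrite II0 card_eq0 => /eqP A0.
  by move: Aa; rewrite A0.
have [iA|] := pselect (convexly_independent A).
  by exists A; split.
move=> /existsNP[a /not_implyP[Aa /contrapT haa]].
have [B [BA iB hB]] := IH (A `\ a) (card_setD1 Aa An).
exists B; split=> //; first by move=> x /BA[].
rewrite hB; apply/seteqP; split; first by apply: convex_hull_mono => x [].
apply: convex_hull_min (@convex_convex_hull _) _ => x Ax.
have [->//|xa] := eqVneq x a.
by apply: sub_convex_hull; split=> //; apply/eqP.
Qed.

Lemma polytope_vertices P : polytope P ->
  [/\ finite_set (vertices P), convexly_independent (vertices P)
    & P = convex_hull (vertices P)].
Proof.
move=> [A fA ->]; have [B [BA iB <-]] := finite_hull_basis fA.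
rewrite vertices_convexly_independent//; split=> //.
exact: sub_finite_set fA.
Qed.

End Hull.

(** * Affine hulls and barycentric coordinates *)

Section Affine.
Context {R : realType} {d : nat}.
Local Notation E := 'rV[R]_d.
Implicit Types (A B C P Q : set E) (x y : E) (v : 'I_(1 + d) -> E).

Lemma affine_affine_hull A : affine_set (affine_hull A).
Proof.
by move=> x y t xA yA C CA; apply: (proj1 CA); [apply: xA|apply: yA].
Qed.

Lemma sub_affine_hull A : A `<=` affine_hull A.
Proof. exact: sub_gen_smallest. Qed.

Lemma affine_hull_min A C : affine_set C -> A `<=` C -> affine_hull A `<=` C.
Proof. exact: smallest_sub. Qed.

Lemma affine_hull_convex_hull A : affine_hull (convex_hull A) = affine_hull A.
Proof.
apply/seteqP; split; apply: affine_hull_min (@affine_affine_hull _) _.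
  apply: convex_hull_min (@sub_affine_hull A).
  by apply/convex_setE => x y t ? ? _; apply: affine_affine_hull.
by move=> x Ax; apply: sub_affine_hull; apply: sub_convex_hull.
Qed.

Lemma has_dim_full A : has_dim A d <-> affine_hull A = setT.
Proof.
split=> [[p [U [-> dimU]]]|AT]; last first.
  exists 0, fullv; rewrite AT; split; last by rewrite dimvf /dim /= mul1n.
  by apply/seteqP; split=> x _; rewrite /= ?memvf.
have -> : U = fullv.
  by apply/eqP; rewrite -(dimv_leqif_eq (subvf U)) dimU dimvf /dim /= mul1n.
by apply/seteqP; split=> x _; rewrite /= ?memvf.
Qed.

(** The translate of an affine set by one of its points is a linear subspace. *)
Lemma affine_set_comb C n (c : 'I_n -> R) (w : 'I_n -> E) p :
  affine_set C -> C p -> (forall i, C (w i)) ->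
  C (p + \sum_i c i *: (w i - p)).
Proof.
move=> aC Cp Cw; apply: (big_ind (fun y => C (p + y))) => [|y z Cy Cz|i _].
- by rewrite addr0.
(* The sum of two vectors is twice their midpoint. *)
- have := aC _ _ 2 (aC _ _ 2^-1 Cy Cz) Cp.
  set u := (X in C X); suff -> : u = p + (y + z) by [].
  by apply/rowP => j; rewrite !mxE; field.
- have := aC _ _ (c i) (Cw i) Cp.
  set u := (X in C X); suff -> : u = p + c i *: (w i - p) by [].
  by apply/rowP => j; rewrite !mxE; ring.
Qed.

(** Embedding the space as the hyperplane of first coordinate [1] turns affine
    dependence and affine span into linear dependence and linear span. *)
Definition homogenize x : 'rV[R]_(1 + d) := row_mx 1%:M x.

Lemma homogenizeEl x : homogenize x 0 (lshift d 0) = 1.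
Proof. by rewrite row_mxEl mxE. Qed.

Lemma homogenizeEr x j : homogenize x 0 (rshift 1 j) = x 0 j.
Proof. by rewrite row_mxEr. Qed.

Definition homogenize_mx n (w : 'I_n -> E) : 'M[R]_(n, 1 + d) :=
  \matrix_i homogenize (w i).

Lemma homogenize_comb x y (t : R) :
  homogenize (t *: x + (1 - t) *: y) =
  t *: homogenize x + (1 - t) *: homogenize y.
Proof.
by rewrite /homogenize !scale_row_mx add_row_mx -scalerDl subrKC scale1r.
Qed.

Lemma homogenize_shift x y z (s : R) :
  homogenize (x + s *: (y - z)) =
  homogenize x + s *: (homogenize y - homogenize z).
Proof.
rewrite /homogenize opp_row_mx add_row_mx subrr scale_row_mx scaler0.
by rewrite add_row_mx addr0.
Qed.

Lemma homogenize_span m (K : 'M[R]_(1 + d, m)) :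
  (forall x, homogenize x *m K = 0) -> K = 0.
Proof.
rewrite -[K]vsubmxK => hK.
have {}hK x : usubmx K + x *m dsubmx K = 0.
  by rewrite -(hK x) mul_row_col mul1mx.
have u0 : usubmx K = 0 by rewrite -(hK 0) mul0mx addr0.
suff -> : dsubmx K = 0 by rewrite u0 col_mx0.
by apply/row_matrixP => i; rewrite row0 rowE -[RHS](hK (delta_mx 0 i)) u0 add0r.
Qed.

(** Otherwise a nonzero affine map would vanish on the family, hence on its
    affine hull, which is everything. *)
Lemma affine_span_row_full n (w : 'I_n -> E) :
  affine_hull (range w) = setT -> row_full (homogenize_mx w).
Proof.
move=> wT; rewrite -cokermx_eq0; apply/eqP/homogenize_span => x.
set K := cokermx _.
have /(_ x) : affine_hull (range w) `<=` [set y | homogenize y *m K = 0].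
  apply: affine_hull_min => [y z t /= yK zK|_ [i _ <-] /=].
    by rewrite homogenize_comb mulmxDl -!scalemxAl yK zK !scaler0 addr0.
  rewrite -[homogenize _](rowK (fun i => homogenize (w i))) -row_mul.
  by rewrite mulmx_coker row0.
by rewrite wT; apply.
Qed.

Definition affine_basis v : bool := homogenize_mx v \in unitmx.

Definition bary v x i : R := (homogenize x *m invmx (homogenize_mx v)) 0 i.

Section Bary.
Variable v : 'I_(1 + d) -> E.
Hypothesis v_basis : affine_basis v.

(** The first coordinate of this identity says that the barycentric
    coordinates sum to [1]; the others express [x] as an affine combination. *)
Lemma homogenize_bary x :
  homogenize x = \sum_i bary v x i *: homogenize (v i).
Proof.
rewrite -[LHS](mulmxKV v_basis) mulmx_sum_row.
by apply: eq_bigr => i _; rewrite rowK.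
Qed.

Lemma bary_comb x y (t : R) i :
  bary v (t *: x + (1 - t) *: y) i = t * bary v x i + (1 - t) * bary v y i.
Proof.
rewrite /bary homogenize_comb mulmxDl -!scalemxAl [LHS]mxE.
by congr (_ + _); rewrite [LHS]mxE.
Qed.

Lemma bary_shift x y z (s : R) i :
  bary v (x + s *: (y - z)) i = bary v x i + s * (bary v y i - bary v z i).
Proof.
rewrite /bary homogenize_shift mulmxDl -scalemxAl mulmxBl [LHS]mxE.
congr (_ + _); rewrite [LHS]mxE; congr (_ * _).
by rewrite [LHS]mxE [X in _ + X]mxE.
Qed.

Lemma bary_basis i j : bary v (v i) j = (i == j)%:R.
Proof.
rewrite /bary -[homogenize _](rowK (fun i => homogenize (v i))) -row_mul.
by rewrite mulmxV// !mxE.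
Qed.

Lemma affine_basis_inj : injective v.
Proof.
move=> i j vij; apply/eqP; have := bary_basis i j; rewrite vij bary_basis eqxx.
by case: (i == j) => // /eqP; rewrite oner_eq0.
Qed.

Lemma affine_basis_span : affine_hull (range v) = setT.
Proof.
apply/seteqP; split=> // x _.
have hx := homogenize_bary x.
have s1 : \sum_i bary v x i = 1.
  have /(congr1 (fun w : 'rV_(1 + d) => w 0 (lshift d 0))) := hx.
  rewrite homogenizeEl summxE => ->; apply: eq_bigr => i _.
  by rewrite [RHS]mxE homogenizeEl mulr1.
have sx : \sum_i bary v x i *: v i = x.
  apply/rowP => j.
  have /(congr1 (fun w : 'rV_(1 + d) => w 0 (rshift 1 j))) := hx.
  rewrite homogenizeEr => ->; rewrite !summxE; apply: eq_bigr => i _.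
  by rewrite [LHS]mxE [RHS]mxE homogenizeEr.
have vA i : affine_hull (range v) (v i) by apply: sub_affine_hull; exists i.
have -> : x = v ord0 + \sum_i bary v x i *: (v i - v ord0).
  under eq_bigr do rewrite scalerBr.
  by rewrite sumrB -scaler_suml s1 scale1r sx subrKC.
exact: affine_set_comb (@affine_affine_hull _) _ _.
Qed.

(** Half-spaces of this form separate one point of a family from the others,
    so that no convex combination ever has to be written down. *)
Lemma halfspace_convex (a b : R) i j :
  @convex_set R E [set x | a * bary v x i <= b * bary v x j].
Proof.
apply/convex_setE => x y t /= hx hy /andP[t0 t1].
rewrite !bary_comb !mulrDr ![a * (_ * _)]mulrCA ![b * (_ * _)]mulrCA.
by apply: lerD; rewrite ler_pM2l ?subr_gt0.
Qed.

Lemma affine_basis_convexly_independent : convexly_independent (range v).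
Proof.
move=> _ [m _ <-] /(convex_hull_min (@halfspace_convex 1 0 m m)) /=.
rewrite bary_basis eqxx mul1r mul0r ler10 => /(_ _)/wrap[]// _ [[i _ <-] vi].
rewrite /= bary_basis mul0r mul1r; have [im|//] := eqVneq.
by case: vi; rewrite im.
Qed.

(** The point [x] is separated from the basis by its negative coordinate. To
    separate [v m] from [x] and the rest of the basis, take an index [r]
    distinct from [m] where [x] is positive: the inequality
    [b_r(x) * b_m <= |b_m(x)| * b_r], where [b_i] is the [i]-th barycentric
    coordinate, holds at [x] and at the other points but fails at [v m]. *)
Lemma circuit_convexly_independent x p q k : p != q ->
  0 < bary v x p -> 0 < bary v x q -> bary v x k < 0 ->
  convexly_independent (range v `|` [set x]).
Proof.
move=> pq xp xq xk a [[m _ <-]|->]; last first.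
  move=> /(convex_hull_min (@halfspace_convex (-1) 0 k k)) /=.
  rewrite mul0r mulN1r oppr_le0 leNgt xk => /(_ _)/wrap[]// y.
  move=> [[[i _ <-]|->] xx] /=; last by case: xx.
  by rewrite bary_basis mul0r mulN1r oppr_le0 ler0n.
have [r rm xr] : exists2 r, r != m & 0 < bary v x r.
  by have [pm|] := eqVneq p m; [exists q; rewrite // -pm eq_sym|exists p].
move=> /(convex_hull_min (@halfspace_convex (bary v x r) `|bary v x m| m r)).
rewrite /= !bary_basis eqxx eq_sym (negbTE rm) mulr1 mulr0 leNgt xr.
move=> /(_ _)/wrap[]// _ [[[i _ <-]|->] vi] /=; last first.
  by rewrite mulrC ler_pM2r// ler_norm.
rewrite !bary_basis; have [im|_] := eqVneq i m; first by case: vi; rewrite im.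
by rewrite mulr0 mulr_ge0.
Qed.

Definition exchange k x : 'I_(1 + d) -> E := fun i => if i == k then x else v i.

(** Relative to [v], the matrix of the new family is the identity with row [k]
    replaced by the coordinates of [x]; its determinant is [bary v x k]. *)
Lemma exchange_affine_basis k x :
  bary v x k != 0 -> affine_basis (exchange k x).
Proof.
move=> xk; rewrite /affine_basis -row_free_unit; apply: inj_row_free => u u0.
have e j : u 0 k * bary v x j + (if j == k then 0 else u 0 j) = 0.
  transitivity
      ((u *m homogenize_mx (exchange k x) *m invmx (homogenize_mx v)) 0 j);
    last by rewrite u0 mul0mx mxE.
  rewrite [u *m _]mulmx_sum_row mulmx_suml summxE (bigD1 k)//=; congr (_ + _).
    by rewrite rowK -scalemxAl [RHS]mxE /exchange eqxx.
  have eb i : i != k -> (u 0 i *: row i (homogenize_mx (exchange k x)) *m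
      invmx (homogenize_mx v)) 0 j = u 0 i * (i == j)%:R.
    move=> ik; rewrite rowK -scalemxAl [LHS]mxE /exchange (negbTE ik).
    by rewrite -/(bary v (v i) j) bary_basis.
  rewrite (eq_bigr _ eb); have [->|jk] := eqVneq j k.
    by rewrite big1// => i /negbTE ->; rewrite mulr0.
  rewrite (bigD1 j)//= eqxx mulr1 big1 ?addr0// => i /andP[_ /negbTE->].
  by rewrite mulr0.
have uk : u 0 k = 0.
  by have /eqP := e k; rewrite eqxx addr0 mulf_eq0 (negbTE xk) orbF => /eqP.
apply/rowP => j; rewrite [RHS]mxE; have [->//|jk] := eqVneq j k.
by have := e j; rewrite uk mul0r add0r (negbTE jk).
Qed.

End Bary.

Lemma finite_spanning_basis A : finite_set A -> affine_hull A = setT ->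
  exists2 v, affine_basis v & range v `<=` A.
Proof.
move=> fA AT; pose s := enum_fset (fset_set A).
pose w (i : 'I_(size s)) : E := nth 0 s i.
have rw : range w = A.
  apply/seteqP; split=> [_ [i _ <-]|x Ax].
    by apply/set_mem; rewrite -in_fset_set// mem_nth.
  have xs : x \in s by rewrite in_fset_set// mem_set.
  have xn : (index x s < size s)%N by rewrite index_mem.
  by exists (Ordinal xn) => //; rewrite /w /= nth_index.
have wfull : row_full (homogenize_mx w).
  by apply: affine_span_row_full; rewrite rw.
exists (fun i => w (fullrankfun wfull i)); last first.
  by rewrite -rw => _ [i _ <-]; exists (fullrankfun wfull i).
have := fullrowsub_unit wfull; rewrite /affine_basis; congr (_ \in unitmx).
by apply/matrixP => i j; rewrite !mxE.
Qed.

End Affine.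

(** * Polytopes as vertex sets, and walks between them *)

Section Walks.
Context {R : realType} {d : nat}.
Local Notation E := 'rV[R]_d.
Implicit Types (A B P Q : set E) (S : set (set E)) (x y : E).
Implicit Types (v w : 'I_(1 + d) -> E).

Lemma bary_change v w x k : affine_basis v ->
  bary w x k = \sum_i bary v x i * bary w (v i) k.
Proof.
move=> bv; rewrite {1}/bary (homogenize_bary bv x) mulmx_suml summxE.
by apply: eq_bigr => i _; rewrite -scalemxAl [LHS]mxE.
Qed.

(** Expand the coordinates of [x] in the new basis along the old one. Only
    [v k] contributes at [k], since the other old vertices are new vertices
    too. *)
Lemma bary_exchange v k x : affine_basis v -> bary v x k != 0 ->
  bary (exchange v k x) (v k) k = (bary v x k)^-1.
Proof.
move=> bv xk; have be := exchange_affine_basis bv xk.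
have := bary_basis be k k; rewrite {2}/exchange !eqxx.
rewrite (bary_change _ _ _ bv) (bigD1 k)//= big1 ?addr0 => [|i ik].
  by move=> h; apply: (mulfI xk); rewrite h mulfV.
have {1}-> : v i = exchange v k x i by rewrite /exchange (negbTE ik).
by rewrite bary_basis// (negbTE ik) mulr0.
Qed.

Lemma range_exchange v k x : injective v -> ~ range v x ->
  range (exchange v k x) = (range v `|` [set x]) `\ v k.
Proof.
move=> vi nx; apply/seteqP; split=> [_ [i _ <-]|y].
  rewrite /exchange; case: eqVneq => [_|ik].
    by split; [right|move=> /= xk; apply: nx; exists k].
  by split; [left; exists i|move=> /vi /eqP; apply/negP].
move=> [[[i _ <-]|->] yk]; last by exists k => //; rewrite /exchange eqxx.
exists i => //; rewrite /exchange; case: eqVneq => // ik.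
by case: yk; rewrite ik.
Qed.

Lemma card_range_basis v : affine_basis v -> (range v #= `I_d.+1)%card.
Proof.
move=> /affine_basis_inj vi; apply: card_eq_trans (@inj_card_eq _ _ setT v _) _.
  by move=> i j _ _; apply: vi.
by rewrite card_eq_sym; apply: card_II.
Qed.

(** These are the vertex sets of the polytopes of the graph, by
    [Lambda_verticesP]; the walks are built at the level of these sets. *)
Definition lattice_vertex_set A :=
  [/\ finite_set A, convexly_independent A, forall a, A a -> lattice_point a
    & affine_hull A = setT].

Lemma Lambda_verticesP P :
  Lambda_vertices P <-> exists2 A, lattice_vertex_set A & P = convex_hull A.
Proof.
split=> [[[/polytope_vertices[fV iV PV] lV] dP]|[A [fA iA lA sA] ->]].
  exists (vertices P) => //; split=> //.
  by rewrite -affine_hull_convex_hull -PV; apply/has_dim_full.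
split; last by apply/has_dim_full; rewrite affine_hull_convex_hull.
split; first by exists A.
by move=> v; rewrite vertices_convexly_independent//; apply: lA.
Qed.

Lemma insertion_edge A x : lattice_vertex_set A ->
  lattice_vertex_set (A `|` [set x]) -> ~ A x ->
  gedge (Lambda R d) (convex_hull A) (convex_hull (A `|` [set x])).
Proof.
move=> cA cAx Ax; split; [by apply/Lambda_verticesP; exists A| |left].
  by apply/Lambda_verticesP; exists (A `|` [set x]).
have [_ iA _ _] := cA; have [_ iAx _ _] := cAx.
exists x; last by rewrite convex_hullU.
split; last by rewrite convex_hullU !vertices_convexly_independent.
move=> hx; apply: (iAx x); first by right.
apply: convex_hull_mono hx => a Aa; split; first by left.
by move=> /= ax; apply: Ax; rewrite -ax.
Qed.

Definition walk S := clos_refl_trans (set E)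
  (fun P Q => [/\ gvertex (induced_subgraph (Lambda R d) S) P,
                  gvertex (induced_subgraph (Lambda R d) S) Q
                & gedge (induced_subgraph (Lambda R d) S) P Q]).

Lemma walk_sym S P Q : walk S P Q -> walk S Q P.
Proof.
elim=> [a b [ga gb [[ea eb e] Sa Sb]]|a|a b c _ ba _ cb].
- by apply: rt_step; split=> //; split=> //; split=> //; apply/or_comm.
- exact: rt_refl.
- exact: rt_trans cb ba.
Qed.

Lemma insertion_walk S A x : lattice_vertex_set A ->
  lattice_vertex_set (A `|` [set x]) -> ~ A x ->
  S (convex_hull A) -> S (convex_hull (A `|` [set x])) ->
  walk S (convex_hull A) (convex_hull (A `|` [set x])).
Proof.
move=> cA cAx Ax SA SAx; have e := insertion_edge cA cAx Ax.
by case: (e) => LA LAx _; apply: rt_step; split.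
Qed.

(** Simplices cannot be joined without the next larger polytopes, so both
    graphs are treated at once as subgraphs induced by a set [S] that contains
    these. *)
Definition few_vertices : set (set E) :=
  has_n_vertices R d d.+1 `|` has_n_vertices R d d.+2.

Definition simplex v := convex_hull (range v).

Definition lattice_basis v := affine_basis v /\ forall i, lattice_point (v i).

Lemma lattice_basis_vertex_set v : lattice_basis v -> lattice_vertex_set (range v).
Proof.
move=> [bv lv]; split=> //; first exact: finite_image.
- exact: affine_basis_convexly_independent.
- by move=> _ [i _ <-].
- exact: affine_basis_span.
Qed.

Lemma exchange_lattice_basis v k x : lattice_basis v -> lattice_point x ->
  bary v x k != 0 -> lattice_basis (exchange v k x).
Proof.
move=> [bv lv] lx xk; split; first exact: exchange_affine_basis.
by move=> i; rewrite /exchange; case: ifP.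
Qed.

Lemma lattice_basis_exists : exists v, lattice_basis v.
Proof.
pose M : 'M[R]_(1 + d, d) := col_mx 0 1%:M; exists (fun i => row i M); split.
  rewrite /affine_basis.
  have -> : homogenize_mx (fun i => row i M) =
      block_mx 1%:M 0 (const_mx 1) (1%:M : 'M[R]_d).
    apply/row_matrixP => i; rewrite rowK block_mxEh row_row_mx; congr row_mx.
    apply/rowP => j; rewrite !ord1 !mxE.
    by case: splitP => l _; rewrite !mxE ?ord1.
  by rewrite unitmxE det_lblock !det1 mulr1 unitr1.
move=> i j; rewrite !mxE.
by case: splitP => l _; rewrite !mxE ?rpred0 ?rpred_nat.
Qed.

(** * Exchanging the vertices of a simplex *)

Section FewVertices.
Variable S : set (set E).
Hypothesis few_S : few_vertices `<=` S.

Lemma simplex_few v : lattice_basis v -> S (simplex v).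
Proof.
move=> lv; apply: few_S; left; rewrite /has_n_vertices /=.
have [_ iv _ _] := lattice_basis_vertex_set lv.
by rewrite vertices_convexly_independent//; apply: card_range_basis; case: lv.
Qed.

(** Insert [x], pass through a polytope with [d + 2] vertices, delete [v k]. *)
Lemma circuit_walk v x p q r k : lattice_basis v -> lattice_point x ->
  p != q -> 0 < bary v x p -> 0 < bary v x q -> bary v x r < 0 ->
  bary v x k != 0 -> walk S (simplex v) (simplex (exchange v k x)).
Proof.
move=> lv lx pq xp xq xr xk; have [bv _] := lv.
have cv := lattice_basis_vertex_set lv; have [fv _ Lv sv] := cv.
have ic := circuit_convexly_independent bv pq xp xq xr.
have nx : ~ range v x.
  move=> [i _ vx]; move: xr; rewrite -vx bary_basis//.
  by rewrite ltNge ler0n.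
have cc : lattice_vertex_set (range v `|` [set x]).
  split=> //; first by rewrite finite_setU; split=> //; apply: finite_set1.
    by move=> a [/Lv//|->].
  apply/seteqP; split=> //; rewrite -sv.
  apply: affine_hull_min (@affine_affine_hull _ _ _) _ => z vz.
  by apply: sub_affine_hull; left.
have Sc : S (convex_hull (range v `|` [set x])).
  apply: few_S; right.
  rewrite /has_n_vertices /= vertices_convexly_independent//.
  exact/card_setU1/card_range_basis.
have rE := range_exchange k (affine_basis_inj bv) nx.
have xvk : x != v k by apply/eqP => xvk; apply: nx; exists k.
have cE : range v `|` [set x] = range (exchange v k x) `|` [set v k].
  rewrite rE; apply/seteqP; split=> [y vy|y [[]//|->]]; last by left; exists k.
  by have [->|/eqP yk] := eqVneq y (v k); [right|left].
apply: rt_trans (insertion_walk cv cc nx (simplex_few lv) Sc) _.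
have le := exchange_lattice_basis lv lx xk.
rewrite cE; apply/walk_sym/insertion_walk; rewrite -?cE//.
- exact: lattice_basis_vertex_set.
- by rewrite rE => -[_]; apply.
- exact: simplex_few.
Qed.

Lemma lattice_point_shift x y z n : lattice_point x -> lattice_point y ->
  lattice_point z -> lattice_point (x + n%:R *: (y - z)).
Proof.
by move=> lx ly lz i; rewrite !mxE rpredD// rpredM// ?rpredB// rpred_nat.
Qed.

(** Both [v k] and [x] can be exchanged for a common point [c], obtained by
    moving [v k] far away in a direction parallel to the opposite facet. *)
Lemma same_side_walk v x i j k : lattice_basis v -> lattice_point x ->
  i != j -> i != k -> j != k -> 0 < bary v x k ->
  walk S (simplex v) (simplex (exchange v k x)).
Proof.
move=> lv lx ij ik jk xk; have [bv Lv] := lv.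
have xk0 : bary v x k != 0 by rewrite gt_eqF.
have lw := exchange_lattice_basis lv lx xk0; have bw := lw.1.
set w := exchange v k x in lw bw *.
have wE l : l != k -> v l = w l by rewrite /w /exchange => /negbTE->.
have wk : 0 < bary w (v k) k by rewrite bary_exchange// invr_gt0.
(* [N] exceeds the absolute values of the coordinates of [v k] at [i] and [j]
   in the basis [w], so that it decides the signs of those of [c]. *)
pose N := (Num.trunc (`|bary w (v k) i| + `|bary w (v k) j|)).+1.
have NB : `|bary w (v k) i| + `|bary w (v k) j| < N%:R by apply: truncnS_gt.
have Ni : `|bary w (v k) i| < N%:R by apply: le_lt_trans NB; rewrite lerDl.
have Nj : `|bary w (v k) j| < N%:R by apply: le_lt_trans NB; rewrite lerDr.
pose c := v k + N%:R *: (v i - v j).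
have lc : lattice_point c by apply: lattice_point_shift.
have wc l : bary w c l = bary w (v k) l + N%:R * ((i == l)%:R - (j == l)%:R).
  by rewrite bary_shift (wE i)// (wE j)// !bary_basis.
have vc l : bary v c l = (k == l)%:R + N%:R * ((i == l)%:R - (j == l)%:R).
  by rewrite bary_shift !bary_basis.
have cE : exchange v k c = exchange w k c.
  by apply/funext => l; rewrite /exchange; case: eqVneq => // lk; rewrite -wE.
have [ji ki kj] : [/\ j == i = false, k == i = false & k == j = false].
  by rewrite ![_ == i]eq_sym [k == j]eq_sym !(negbTE ij, negbTE ik, negbTE jk).
have N0 : 0 < N%:R :> R by rewrite ltr0n.
apply: (@rt_trans _ _ _ (simplex (exchange v k c))).
  apply: (@circuit_walk v c i k j k) => //;
    rewrite vc ?eqxx ?ji ?ki ?kj ?(negbTE ij) ?(negbTE ik) ?(negbTE jk).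
  - by rewrite subr0 mulr1 add0r.
  - by rewrite subrr mulr0 addr0.
  - by rewrite sub0r mulrN1 add0r oppr_lt0.
  - by rewrite subrr mulr0 addr0 oner_eq0.
rewrite cE; apply: walk_sym.
apply: (@circuit_walk w c i k j k) => //;
    rewrite wc ?eqxx ?ji ?ki ?kj ?(negbTE ij) ?(negbTE ik) ?(negbTE jk).
- rewrite subr0 mulr1 -ltrBlDl sub0r; apply: le_lt_trans Ni.
  by rewrite -normrN ler_norm.
- by rewrite subrr mulr0 addr0.
- by rewrite sub0r mulrN1 subr_lt0; apply: le_lt_trans Nj; rewrite ler_norm.
- by rewrite subrr mulr0 addr0 gt_eqF.
Qed.

Hypothesis d_ge2 : (2 <= d)%N.

(** If [x] is on the other side of the facet, [v k] is first sent across it to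
    [y], its reflection through the midpoint of the edge from [v i] to [v j]. *)
Lemma facet_walk v x k : lattice_basis v -> lattice_point x ->
  bary v x k != 0 -> walk S (simplex v) (simplex (exchange v k x)).
Proof.
move=> lv lx xk; have [bv Lv] := lv.
have [i [j [ik jk ij]]] : exists i j, [/\ i != k, j != k & i != j].
  have : (1 < #|[set~ k]%SET|)%N by rewrite cardsC1 card_ord.
  by move=> /card_gt1P[i [j []]]; rewrite !inE => ik jk ij; exists i, j.
have [xk0|xk0] := ltrP 0 (bary v x k); first exact: (@same_side_walk v x i j k).
have {xk0}xk0 : bary v x k < 0 by rewrite lt_neqAle xk.
pose y := v i + 1%:R *: (v j - v k).
have ly : lattice_point y by apply: lattice_point_shift.
have vy l : bary v y l = (i == l)%:R + ((j == l)%:R - (k == l)%:R).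
  by rewrite bary_shift !bary_basis// mul1r.
have [ji ki kj] : [/\ j == i = false, k == i = false & k == j = false].
  by rewrite ![_ == i]eq_sym [k == j]eq_sym !(negbTE ij, negbTE ik, negbTE jk).
have yk : bary v y k = -1.
  by rewrite vy (negbTE ik) (negbTE jk) eqxx sub0r add0r.
have yk0 : bary v y k != 0 by rewrite yk oppr_eq0 oner_eq0.
have lw := exchange_lattice_basis lv ly yk0.
apply: (@rt_trans _ _ _ (simplex (exchange v k y))).
  apply: (@circuit_walk v y i j k k) => //.
  - by rewrite vy eqxx ji ki subrr addr0.
  - by rewrite vy eqxx (negbTE ij) kj subr0 add0r.
  - by rewrite yk oppr_lt0.
have -> : exchange v k x = exchange (exchange v k y) k x.
  by apply/funext => l; rewrite /exchange; case: eqVneq.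
apply: (@same_side_walk _ x i j k) => //.
rewrite (bary_change _ _ _ bv) (bigD1 k)//= big1 ?addr0 => [|l lk].
  by rewrite bary_exchange// yk invrN1 mulrN1 oppr_gt0.
have {1}-> : v l = exchange v k y l by rewrite /exchange (negbTE lk).
by rewrite bary_basis ?(negbTE lk) ?mulr0//; case: lw.
Qed.

Lemma simplex_tperm v i k : simplex (fun j => v (tperm i k j)) = simplex v.
Proof.
congr convex_hull; apply/seteqP; split=> _ [j _ <-].
  by exists (tperm i k j).
by exists (tperm i k j) => //; rewrite tpermK.
Qed.

Lemma lattice_basis_tperm v i k : lattice_basis v ->
  lattice_basis (fun j => v (tperm i k j)).
Proof.
move=> [bv lv]; split=> //; rewrite /affine_basis.
suff -> : homogenize_mx (fun j => v (tperm i k j)) =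
    row_perm (tperm i k) (homogenize_mx v).
  by rewrite row_permE unitmx_mul unitmx_perm.
by apply/matrixP => a b; rewrite !mxE.
Qed.

(** Exchange argument: if [v] and [w] agree before the index [k], then [w k] has
    a nonzero coordinate at some [i >= k], since otherwise it would depend on
    the earlier [w i]. So [v i] can be exchanged for [w k]. *)
Lemma simplex_walk v w : lattice_basis v -> lattice_basis w ->
  walk S (simplex v) (simplex w).
Proof.
move=> lv lw.
suff : forall m v, lattice_basis v ->
    (forall i : 'I_(1 + d), (i < d.+1 - m)%N -> v i = w i) ->
  walk S (simplex v) (simplex w).
  by move=> /(_ d.+1 v lv); apply=> i; rewrite subnn.
elim=> [|m IH] {}v {}lv vw.
  have -> : v = w by apply/funext => i; apply: vw; rewrite subn0.
  exact: rt_refl.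
have [md|md] := leqP d.+1 m.
  by apply: IH => // i; move: (md); rewrite -subn_eq0 => /eqP ->.
have kd : (d - m < 1 + d)%N by rewrite add1n ltnS leq_subr.
pose k := Ordinal kd.
have [i ik ti] : exists2 i : 'I_(1 + d), (d - m <= i)%N & bary v (w k) i != 0.
  apply: contrapT => /forall2NP h; have := bary_basis lw.1 k k.
  rewrite eqxx (bary_change _ _ _ lv.1) big1 => [/esym/eqP|i _].
    by rewrite oner_eq0.
  have [/negP|/negP] := h i; last by rewrite negbK => /eqP ->; rewrite mul0r.
  rewrite -ltnNge => im; rewrite vw ?subSS// bary_basis//; last exact: lw.1.
  by rewrite -(inj_eq val_inj) /= ltn_eqF ?mulr0.
apply: rt_trans (facet_walk lv (lw.2 k) ti) _.
(* The new vertex is moved to position [k], which leaves the simplex as is. *)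
rewrite -(simplex_tperm _ i k); apply: IH.
  apply: lattice_basis_tperm; exact: exchange_lattice_basis (lw.2 k) ti.
move=> j; rewrite subSn// ltnS leq_eqVlt => /orP[/eqP jk|jk].
  have -> : j = k by apply/val_inj.
  by rewrite tpermR /exchange eqxx.
have ji : j != i by rewrite -(inj_eq val_inj) /= ltn_eqF// (leq_trans jk).
have jk' : j != k by rewrite -(inj_eq val_inj) /= ltn_eqF.
by rewrite tpermD 1?eq_sym// /exchange (negbTE ji) vw// subSS.
Qed.

(** * Reaching a simplex, and connectedness *)

Hypothesis S_delete : forall A a, lattice_vertex_set A -> A a ->
  lattice_vertex_set (A `\ a) -> S (convex_hull A) -> S (convex_hull (A `\ a)).

(** Any vertex outside an affine basis chosen among the vertices can be deleted,
    as the basis keeps the dimension full; the number of vertices decreases. *)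
Lemma walk_to_simplex A : lattice_vertex_set A -> S (convex_hull A) ->
  exists2 v, lattice_basis v & walk S (convex_hull A) (simplex v).
Proof.
move=> cA; have [/finite_setP[n An] _ _ _] := cA.
elim: n A An cA => [|n IH] A An cA SA; have [fA iA lA sA] := cA;
  have [v bv vA] := finite_spanning_basis fA sA.
  move: An; rewrite II0 card_eq0 => /eqP A0.
  by have := vA (v ord0); rewrite A0; case; exists ord0.
have lv : lattice_basis v by split=> // i; apply: lA; apply: vA; exists i.
have [Av|] := pselect (A `<=` range v).
  exists v => //; have -> : A = range v by apply/seteqP.
  exact: rt_refl.
move=> /existsNP[a /not_implyP[Aa nva]].
have cAa : lattice_vertex_set (A `\ a).
  split; first exact: finite_setD.
  - by apply: convexly_independentS iA => x [].
  - by move=> x [/lA].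
  - apply/seteqP; split=> //; rewrite -(affine_basis_span bv).
    apply: affine_hull_min (@affine_affine_hull _ _ _) _ => x vx.
    apply: sub_affine_hull; split; first exact: vA.
    by move=> /= xa; apply: nva; rewrite -xa.
have Aa_eq : A `\ a `|` [set a] = A by rewrite setUC setD1K.
have SAa := S_delete cA Aa cAa SA.
have [u lu wu] := IH _ (card_setD1 Aa An) cAa SAa.
exists u => //; apply: rt_trans wu; apply: walk_sym.
by rewrite -{2}Aa_eq; apply: insertion_walk; rewrite ?Aa_eq// => -[_]; apply.
Qed.

Lemma induced_connected : graph_connected (induced_subgraph (Lambda R d) S).
Proof.
split=> [|P Q [/Lambda_verticesP[A cA ->] SA] [/Lambda_verticesP[B cB ->] SB]].
  have [v lv] := lattice_basis_exists; exists (simplex v).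
  split; last exact: simplex_few.
  by apply/Lambda_verticesP; exists (range v) => //;
    apply: lattice_basis_vertex_set.
have [v lv Av] := walk_to_simplex cA SA.
have [w lw Bw] := walk_to_simplex cB SB.
apply: rt_trans Av _; apply: rt_trans (simplex_walk lv lw) _.
exact: walk_sym.
Qed.

End FewVertices.

(** A full-dimensional polytope has at least [d + 1] vertices, so a legal
    deletion never starts from a simplex. *)
Lemma few_vertices_delete A a : lattice_vertex_set A -> A a ->
  lattice_vertex_set (A `\ a) -> few_vertices (convex_hull A) ->
  few_vertices (convex_hull (A `\ a)).
Proof.
move=> [_ iA _ _] Aa [fD iD _ sD].
rewrite /few_vertices /has_n_vertices /setU /=.
rewrite !vertices_convexly_independent// => -[] /(card_setD1 Aa) Dn;
  last by left.
have [v bv vD] := finite_spanning_basis fD sD.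
have /card_fset_set cv := card_range_basis bv.
have /fsubset_leq_card : (fset_set (range v) `<=` fset_set (A `\ a))%fset.
  by rewrite -fset_set_sub//; apply: finite_image.
by rewrite cv (card_fset_set Dn) ltnn.
Qed.

End Walks.

Theorem theorem4p3 (R : realType) (d : nat) (d_ge2 : (2 <= d)%N) :
  graph_connected (Lambda R d) /\
  graph_connected
    (induced_subgraph (Lambda R d)
       (has_n_vertices R d d.+1 `|` has_n_vertices R d d.+2)).
Proof.
split; last first.
  exact: (induced_connected (fun _ => id) d_ge2 (@few_vertices_delete R d)).
have [[P [LP _]] walkT] := @induced_connected R d setT (fun _ _ => I) d_ge2
  (fun _ _ _ _ _ _ => I).
split=> [|A B LA LB]; first by exists P.
have := walkT A B (conj LA I) (conj LB I).
elim=> [a b [[La _] [Lb _] [e _ _]]|a|a b c _ ab _ bc].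
- exact: rt_step.
- exact: rt_refl.
- exact: rt_trans ab bc.
Qed.
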